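(* Let $k\ge2$, let $R$ be a commutative ring with $1$, let $X$ be a simplicial complex with an admissible $\mathbb{Z}_k\times\mathbb{N}$-labelling $\ell$, and let $x\in C_r(X;R)$ be an $r$-chain, $r\ge1$. Depending on the parity of $r$, the following identities hold in $R$, where all label patterns are counted with multiplicities and according to orientation. (1) If $r=2s$: the number of label patterns $h_0\otimes\cdots\otimes h_{2s-1}$ in $\partial x$ such that $g\otimes h_0\otimes\cdots\otimes h_{2s-1}$ is strongly alternating equals the number of all strongly alternating label patterns occurring in $x$. (2) If $r=2s+1$: the number of label patterns $h_0\otimes\cdots\otimes h_{2s}$ occurring in $\partial x$ that are strongly alternating and satisfy $h_0=e$ equals the number of label patterns $h_0\otimes\cdots\otimes h_{2s+1}$ occurring in $x$ such that $e\otimes h_0\otimes\cdots\otimes h_{2s+1}$ is strongly alternating, minus the number of label patterns $h_0\otimes\cdots\otimes h_{2s+1}$ occurring in $x$ such that $g\otimes h_0\otimes\cdots\otimes h_{2s+1}$ is strongly alternating.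
   Context: $\mathbb{Z}_k=\{e,g,\dots,g^{k-1}\}$ is the cyclic group of order $k$, written multiplicatively, with generator $g$; $\mathbb{N}$ is the set of positive integers. $C_\bullet(X;R)$ is the simplicial chain complex of $X$ with coefficients in $R$. Labelling: a map $\ell\colon V(X)\to\mathbb{Z}_k\times\mathbb{N}$ on the vertex set; for $\ell(v)=(s,c)$, $s$ is the sign and $c$ the color of $v$. It is admissible if the two vertices of any edge of $X$ always carry different colors or the same sign. Patterns: let $S_r$ be the free $R$-module with basis the symbols $h_0\otimes\cdots\otimes h_r$, $h_i\in\mathbb{Z}_k$. Define the $R$-linear map $h^\ell_r\colon C_r(X;R)\to S_r$ on an oriented simplex $\langle v_0,\dots,v_r\rangle$ with $\ell(v_i)=(s_i,c_i)$ as follows: if the colors $c_0,\dots,c_r$ are pairwise distinct, the image is $\operatorname{sign}(\pi)\, s_{\pi(0)}\otimes\cdots\otimes s_{\pi(r)}$, where $\pi$ is the permutation of $\{0,\dots,r\}$ with $c_{\pi(0)}<\cdots<c_{\pi(r)}$; otherwise the image is $0$. The element $s_{\pi(0)}\otimes\cdots\otimes s_{\pi(r)}$ is the label pattern assigned to the simplex. For a chain $y\in C_r(X;R)$, ''the number of label patterns $h_0\otimes\cdots\otimes h_r$ occurring in $y$ having a property $P$, counted with multiplicities and according to orientation'' means the sum in $R$ of the coefficients in $h^\ell_r(y)$ of all basis elements $h_0\otimes\cdots\otimes h_r$ having property $P$. Strongly alternating: for $h_0,\dots,h_{2s}\in\mathbb{Z}_k$, let $0\le a_j<k$ ($1\le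 j\le 2s$) be defined by $h_{j-1}^{-1}h_j=g^{a_j}$. The element $h_0\otimes\cdots\otimes h_{2s}$ is strongly alternating if $a_{2i+1}+a_{2i+2}\ge k$ for all $0\le i\le s-1$ (vacuous for $s=0$). *)

(* Defs.v *)
From HB Require Import structures.
From mathcomp Require Import all_boot all_order all_algebra all_fingroup finmap.
From mathcomp Require Import monalg.

Set Implicit Arguments.
Unset Strict Implicit.
Unset Printing Implicit Defensive.

Import GRing.Theory.

Local Open Scope fset_scope.
Local Open Scope ring_scope.

(* The carrier is that of {malg R[K]}; monalg only provides the R-module
   structure for non-trivial R, whence the instance below. *)
Definition free_module (R : pzRingType) (K : choiceType) : Type := {malg R[K]}.

Section FreeModule.
Variables (R : pzRingType) (K : choiceType).
Local Notation F := (free_module R K).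

HB.instance Definition _ := GRing.Zmodule.copy F {malg R[K]}.

Definition fm_scale (c : R) (y : F) : F := [malg x in msupp y => c * y@_x].

Lemma fm_scaleE c y x : (fm_scale c y)@_x = c * y@_x.
Proof.
rewrite mcoeffE; case: ifPn => // xNy.
by rewrite mcoeff_outdom ?mulr0.
Qed.

Lemma fm_scaleA c1 c2 y : fm_scale c1 (fm_scale c2 y) = fm_scale (c1 * c2) y.
Proof. by apply/malgP => x; rewrite !fm_scaleE mulrA. Qed.

Lemma fm_scale1 : left_id 1 fm_scale.
Proof. by move=> y; apply/malgP => x; rewrite fm_scaleE mul1r. Qed.

Lemma fm_scaleDr : right_distributive fm_scale +%R.
Proof.
by move=> c y z; apply/malgP => x; rewrite fm_scaleE !mcoeffD !fm_scaleE mulrDr.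
Qed.

Lemma fm_scaleDl y : {morph fm_scale^~ y : a b / a + b}.
Proof.
by move=> a b; apply/malgP => x; rewrite mcoeffD !fm_scaleE mulrDl.
Qed.

HB.instance Definition _ := GRing.Zmodule_isLmodule.Build R F
  fm_scaleA fm_scale1 fm_scaleDr fm_scaleDl.

Lemma fm_coeffZ c (y : F) x : (c *: y)@_x = c * y@_x.
Proof. exact: fm_scaleE. Qed.

Definition fm_gen (x : K) : F := << (1 : R) *g x >>.

Definition fm_lift (M : lmodType R) (f : K -> M) (y : F) : M :=
  \sum_(x <- msupp y) y@_x *: f x.

Variables (M : lmodType R) (f : K -> M).

Lemma fm_liftEw (D : {fset K}) (y : F) : msupp y `<=` D ->
  fm_lift f y = \sum_(x <- D) y@_x *: f x.
Proof.
move=> yD; rewrite /fm_lift (big_fset_incl _ yD) // => x _ xNy.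
by rewrite mcoeff_outdom ?scale0r.
Qed.

Fact fm_lift_is_linear : linear (fm_lift f).
Proof.
move=> c y z; pose D := msupp (c *: y + z) `|` (msupp y `|` msupp z).
rewrite !(@fm_liftEw D) ?fsubsetUl //.
- rewrite scaler_sumr -big_split; apply: eq_bigr => x _ /=.
  by rewrite mcoeffD fm_coeffZ scalerDl scalerA.
- by rewrite /D fsetUA fsubsetUr.
- by rewrite /D fsetUCA fsubsetUl.
Qed.

HB.instance Definition _ :=
  GRing.isLinear.Build R F M *:%R (fm_lift f) fm_lift_is_linear.

Lemma fm_lift_gen x : fm_lift f (fm_gen x) = f x.
Proof.
rewrite (@fm_liftEw [fset x]) ?msuppU_le // big_seq_fset1.
by rewrite mcoeffUU scale1r.
Qed.

End FreeModule.

Record simplicial_complex (V : choiceType) := SimplicialComplex {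
  faces : pred {fset V};
  _ : ~~ faces fset0;
  _ : forall v : V, faces [fset v];
  _ : forall A B : {fset V}, faces A -> B `<=` A -> B != fset0 -> faces B }.

Definition subfamily (V : Type) m n (v : n.-tuple V) (f : 'I_m -> 'I_n) :
    m.-tuple V :=
  [tuple tnth v (f i) | i < m].

Section Chains.
Variables (R : comPzRingType) (V : choiceType) (X : simplicial_complex V).

Definition simplex (r : nat) : Type :=
  {A : {fset V} | faces X A && (#|` A| == r.+1)}.

Lemma verts_subproof r (A : simplex r) : size (enum_fset (val A)) == r.+1.
Proof. by case/andP: (valP A). Qed.

(* An arbitrary ordering of the vertices of each simplex; the orderings of
   different simplices need not be compatible. *)
Definition verts r (A : simplex r) : r.+1.-tuple V := Tuple (verts_subproof A).

(* The generator of A stands for A oriented by verts A. *)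
Definition chain (r : nat) : Type := free_module R (simplex r).

(* The oriented simplex <v_0, ..., v_r>, and 0 if v_0, ..., v_r are not the
   r + 1 distinct vertices of a simplex of X. *)
Definition oriented r (v : r.+1.-tuple V) : chain r :=
  if insub [fset x in (v : seq V)] is Some A then
    if [pick p : 'S_r.+1 | v == subfamily (verts A) p] is Some p
    then (-1) ^+ p *: fm_gen R (A : simplex r) else 0
  else 0.

Definition boundary r : chain r.+1 -> chain r :=
  fm_lift (fun A : simplex r.+1 =>
    \sum_(i < r.+2) (-1) ^+ i *: oriented (subfamily (verts A) (lift i))).

HB.instance Definition _ r := GRing.Linear.on (@boundary r).

End Chains.

Section Labels.
Variables (k : nat) (R : comPzRingType) (V : choiceType).
Variable X : simplicial_complex V.

(* 'Z_k is written additively: e is 0, g is 1 and g^a is a%:R. *)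
Definition labelling := V -> 'Z_k * nat.

Definition is_labelling (l : labelling) := forall v, (0 < (l v).2)%N.

Definition admissible (l : labelling) :=
  forall u v, u != v -> faces X [fset u; v] ->
    (l u).2 <> (l v).2 \/ (l u).1 = (l v).1.

Definition patterns (r : nat) : Type := free_module R (r.+1.-tuple 'Z_k).

Variable l : labelling.

Definition color_sorts r (v : r.+1.-tuple V) (p : 'S_r.+1) :=
  [forall i : 'I_r.+1, forall j : 'I_r.+1, (i < j)%N ==>
     ((l (tnth v (p i))).2 < (l (tnth v (p j))).2)%N].

(* A permutation strictly sorting the colors exists iff they are pairwise
   distinct, and it is then unique. *)
Definition simplex_pattern r (v : r.+1.-tuple V) : patterns r :=
  if [pick p | color_sorts v p] is Some p then
    (-1) ^+ p *: fm_gen R [tuple (l (tnth v (p i))).1 | i < r.+1]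
  else 0.

Definition pattern r : chain R X r -> patterns r :=
  fm_lift (fun A : simplex X r => simplex_pattern (verts A)).

HB.instance Definition _ r := GRing.Linear.on (@pattern r).

Definition pattern_count r (y : chain R X r) (P : pred (seq 'Z_k)) : R :=
  \sum_(h : r.+1.-tuple 'Z_k | P h) (pattern y)@_h.

End Labels.

Section StronglyAlternating.
Variable k : nat.

(* The exponent a_j in [0, k) with h_{j-1}^-1 h_j = g^{a_j}, for j >= 1. *)
Definition step (h : seq 'Z_k) (j : nat) : nat :=
  nat_of_ord (nth 0 h j - nth 0 h j.-1).

(* Meant for a sequence h of size 2s + 1. *)
Definition strongly_alternating (s : nat) (h : seq 'Z_k) : bool :=
  [forall i : 'I_s, (k <= step h i.*2.+1 + step h i.*2.+2)%N].

End StronglyAlternating.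

Arguments strongly_alternating {k} s h.

Lemma subfamily_comp (V : Type) m n q (v : n.-tuple V) (f : 'I_m -> 'I_n)
    (g : 'I_q -> 'I_m) :
  subfamily (subfamily v f) g = subfamily v (f \o g).
Proof. by apply: eq_from_tnth => i; rewrite !tnth_mktuple. Qed.

Lemma eq_subfamily (V : Type) m n (v : n.-tuple V) (f g : 'I_m -> 'I_n) :
  f =1 g -> subfamily v f = subfamily v g.
Proof. by move=> fg; apply: eq_from_tnth => i; rewrite !tnth_mktuple fg. Qed.

Lemma mem_subfamily (V : eqType) n (v : n.-tuple V) (p : 'S_n) :
  subfamily v p =i v.
Proof.
move=> x; apply/tnthP/tnthP => -[i ->].
  by exists (p i); rewrite tnth_mktuple.
by exists (p^-1%g i); rewrite tnth_mktuple permKV.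
Qed.

(* The choice of the orderings verts is immaterial: oriented simplices obey the
   sign rule, and boundary and pattern have their defining formulas on all of
   them. *)
Section Orientation.
Variables (R : comPzRingType) (V : choiceType) (X : simplicial_complex V).

Lemma verts_inj r (A : simplex X r) : injective (tnth (verts A)).
Proof. by apply/tuple_uniqP; rewrite /= fset_uniq. Qed.

Lemma fset_verts r (A : simplex X r) (p : 'S_r.+1) :
  [fset x in (subfamily (verts A) p : seq V)] = val A.
Proof.
apply/fsetP => x; rewrite inE.
by transitivity (x \in verts A); first exact: (mem_subfamily (verts A) p x).
Qed.

Lemma oriented_verts r (A : simplex X r) (p : 'S_r.+1) :
  oriented R X (subfamily (verts A) p) = (-1) ^+ p *: fm_gen R A.
Proof.
rewrite /oriented fset_verts valK.
case: pickP => [q /eqP eqq|/(_ p)]; last by rewrite eqxx.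
suff -> : q = p by [].
apply/permP => i; apply: (@verts_inj _ A).
by move/(congr1 (fun t => tnth t i)): eqq; rewrite !tnth_mktuple.
Qed.

Lemma simplexP r (v : r.+1.-tuple V) : uniq v -> faces X [fset x in (v : seq V)] ->
  exists A : simplex X r, exists p : 'S_r.+1, v = subfamily (verts A) p.
Proof.
move=> uv fv.
have H : faces X [fset x in (v : seq V)] && (#|` [fset x in (v : seq V)]| == r.+1).
  by rewrite fv card_fseq undup_id // size_tuple /=.
pose A : simplex X r := exist (fun A => is_true (faces X A && (#|` A| == r.+1))) _ H; exists A.
have : perm_eq v (verts A).
  apply: uniq_perm => //; first exact: (fset_uniq (val A)).
  by move=> x; transitivity (x \in val A); first rewrite inE.
case/tuple_permP => p vE; exists p; by apply: val_inj; exact: vE.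
Qed.

Lemma oriented_perm r (v : r.+1.-tuple V) (p : 'S_r.+1) :
  uniq v -> faces X [fset x in (v : seq V)] ->
  oriented R X (subfamily v p) = (-1) ^+ p *: oriented R X v.
Proof.
move=> uv fv; have [A [q ->]] := simplexP uv fv.
rewrite subfamily_comp oriented_verts scalerA -signr_addb -odd_permM -oriented_verts.
by congr oriented; apply: eq_subfamily => i; rewrite permM.
Qed.

Variables (k : nat) (l : labelling k V).


Lemma color_sorts_inj r (v : r.+1.-tuple V) p q :
  color_sorts l v p -> color_sorts l v q -> p = q.
Proof.
pose c i := (l (tnth v i)).2.
have hs p' : color_sorts l v p' -> sorted ltn [seq c (p' i) | i <- enum 'I_r.+1].
  move=> H; rewrite sorted_map.
  have: sorted (relpre val ltn) (enum 'I_r.+1).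
    by rewrite -sorted_map val_enum_ord iota_ltn_sorted.
  apply: sub_sorted => a b ab.
  by move/forallP/(_ a)/forallP/(_ b)/implyP: H; apply.
move=> hp hq.
have E : [seq c (p i) | i <- enum 'I_r.+1] = [seq c (q i) | i <- enum 'I_r.+1].
  apply: (irr_sorted_eq ltn_trans ltnn) (hs _ hp) (hs _ hq) _ => x.
  apply/mapP/mapP => -[i _ ->].
    by exists (q^-1%g (p i)); rewrite ?mem_enum ?permKV.
  by exists (p^-1%g (q i)); rewrite ?mem_enum ?permKV.
have {}E : forall i, c (p i) = c (q i).
  by move=> i; have /eq_in_map := E; apply; rewrite mem_enum.
have cI : injective c.
  move=> i j cij; apply: (can_inj (permKV p)); apply/val_inj.
  have H (a b : 'I_r.+1) : (a < b)%N -> (c (p a) < c (p b))%N.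
    by move=> ab; move/forallP/(_ a)/forallP/(_ b)/implyP: hp; apply.
  case: (ltngtP (p^-1%g i) (p^-1%g j)) => [/H|/H|//];
    by rewrite !permKV cij ltnn.
by apply/permP => i; apply: cI.
Qed.

Lemma color_sorts_perm r (v : r.+1.-tuple V) (p q : 'S_r.+1) :
  color_sorts l (subfamily v p) q = color_sorts l v (q * p)%g.
Proof.
by apply: eq_forallb => i; apply: eq_forallb => j; rewrite !tnth_mktuple !permM.
Qed.

Lemma simplex_patternE r (v : r.+1.-tuple V) p : color_sorts l v p ->
  simplex_pattern R l v = 
  (-1) ^+ p *: fm_gen R [tuple (l (tnth v (p i))).1 | i < r.+1].
Proof.
move=> hp; rewrite /simplex_pattern; case: pickP => [q hq|/(_ p)]; last by rewrite hp.
by rewrite (color_sorts_inj hq hp).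
Qed.

Lemma simplex_pattern_perm r (v : r.+1.-tuple V) (p : 'S_r.+1) :
  simplex_pattern R l (subfamily v p) = (-1) ^+ p *: simplex_pattern R l v.
Proof.
case: (pickP (color_sorts l v)) => [q hq|h0]; last first.
  rewrite /simplex_pattern; case: pickP => [q|_]; first by rewrite color_sorts_perm h0.
  by case: pickP => [q|_]; rewrite ?h0 ?scaler0.
have hq' : color_sorts l (subfamily v p) (q * p^-1)%g.
  by rewrite color_sorts_perm mulgKV.
rewrite (simplex_patternE hq) (simplex_patternE hq') scalerA -signr_addb.
rewrite odd_permM odd_permV addbC; congr (_ *: fm_gen R _).
by apply: eq_from_tnth => i; rewrite !tnth_mktuple permM permKV.
Qed.

Lemma pattern_oriented r (v : r.+1.-tuple V) :
  uniq v -> faces X [fset x in (v : seq V)] ->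
  pattern l (oriented R X v) = simplex_pattern R l v.
Proof.
move=> uv fv; have [A [q ->]] := simplexP uv fv.
by rewrite oriented_verts linearZ /= /pattern fm_lift_gen simplex_pattern_perm.
Qed.

Lemma perm_lift n (p : 'S_n.+2) (i : 'I_n.+2) :
  exists q : 'S_n.+1, p = lift_perm i (p i) q.
Proof.
have h j : {j' | p (lift i j) = lift (p i) j'}.
  case: (unliftP (p i) (p (lift i j))) => [j' ->|]; first by exists j'.
  by move/perm_inj/eqP; rewrite eq_sym (negbTE (neq_lift _ _)).
have inj : injective (fun j => sval (h j)).
  move=> a b ab; apply/(@lift_inj _ i)/(@perm_inj _ p).
  by rewrite (svalP (h a)) (svalP (h b)) ab.
exists (perm inj); apply/permP => j.
case: (unliftP i j) => [j'|] ->; last by rewrite lift_perm_id.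
by rewrite lift_perm_lift permE; exact: (svalP (h j')).
Qed.

Lemma boundary_oriented r (v : r.+2.-tuple V) :
  uniq v -> faces X [fset x in (v : seq V)] ->
  boundary (oriented R X v) =
  \sum_(i < r.+2) (-1) ^+ i *: oriented R X (subfamily v (lift i)).
Proof.
move=> uv fv; have [A [p ->]] := simplexP uv fv.
rewrite oriented_verts linearZ /= /boundary fm_lift_gen scaler_sumr.
rewrite (reindex_inj (@perm_inj _ p)); apply: eq_bigr => i _ /=.
have [q pq] := perm_lift p i.
set w := subfamily (verts A) (lift (p i)).
have -> : subfamily (subfamily (verts A) p) (lift i) = subfamily w q.
  rewrite !subfamily_comp; apply: eq_subfamily => j /=.
  by rewrite [in LHS]pq lift_perm_lift.
have wv : {subset w <= verts A}.
  by move=> x /tnthP[j ->]; rewrite tnth_mktuple mem_tnth.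
have uw : uniq w.
  by apply/tuple_uniqP => a b; rewrite !tnth_mktuple => /verts_inj/lift_inj.
have fw : faces X [fset x in (w : seq V)].
  case: X A w wv {uv fv uw} => F F0 F1 FS A w wv.
  apply: (FS (val A)); first by case/andP: (valP A).
    by apply/fsubsetP => x; rewrite inE => /wv.
  apply/fset0Pn; exists (tnth w ord0); rewrite inE; exact: mem_tnth.
rewrite (oriented_perm _ uw fw) !scalerA; congr (_ *: _).
rewrite -(signr_odd _ (p i)) -(signr_odd _ i) -!signr_addb pq odd_lift_perm.
rewrite lift_perm_id; congr (_ ^+ nat_of_bool _).
by case: (odd i); case: (odd (p i)); case: (odd_perm q).
Qed.
End Orientation.

(* Main.v *)
From HB Require Import structures.
Require Import Defs.
From mathcomp Require Import all_boot all_order all_algebra all_fingroup finmap.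
From mathcomp Require Import monalg.
From mathcomp Require Import zify ring.

(** Label patterns are simplices of the full simplex on the group of signs, and
    an admissible labelling makes [pattern l] a chain map: pairing the pattern
    of a boundary with a cochain [f] is pairing the pattern of the chain with
    the coboundary of [f] ([pattern_chain_map]).  Both counting identities
    are then identities between cochains, checked on one pattern at a time.

    For the chain map property, chains are spanned by oriented simplices whose
    colors are weakly increasing.  If the colors are strictly increasing,
    patterns of faces are faces of the pattern.  Otherwise two consecutive
    vertices share their color, hence by admissibility their label; the two
    faces opposite to them have the same pattern and opposite signs, and every
    other face, like the simplex itself, has a repeated color and no pattern.

    For the cochain identities, the condition on one pair of steps of a
    strongly alternating pattern says that a carry occurs when the two steps
    are added as residues below k.  Over the integers, k times the carry is
    the coboundary of the step function, so the carry is a 2-cocycle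
    ([carry_cocycle]), and the indicator of strong alternation is its s-th cup
    power, hence a cocycle ([coboundary_sa_eq0]).  Writing out the cocycle
    condition for g followed by h gives the even case.  In the odd case the
    coboundary of the indicator restricted to patterns starting at e is
    ([h_1 = e] - [h_0 = e]) times the indicator of h_1, h_2, and so on; the
    first factor is the difference of the carries of (e, h_0, h_1) and
    (g, h_0, h_1) by [carry_shift], since stepping from g instead of e lowers
    the residue by one and wraps around exactly at e. *)

Set Implicit Arguments.
Unset Strict Implicit.
Unset Printing Implicit Defensive.

Import GRing.Theory.

Local Open Scope ring_scope.

(** * Cochains on sequences *)

Definition face (T : Type) (i : nat) (h : seq T) : seq T :=
  take i h ++ drop i.+1 h.

Definition coboundary (T : Type) (R : pzRingType) (f : seq T -> R)
    (h : seq T) : R :=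
  \sum_(i < size h) (-1) ^+ i * f (face i h).

Section Coboundary.
Variables (T : Type) (R : comPzRingType).
Implicit Types (f : seq T -> R) (h : seq T).

Lemma coboundary_cons f x h :
  coboundary f (x :: h) = f h - coboundary (fun t => f (x :: t)) h.
Proof.
rewrite /coboundary big_ord_recl /= expr0 mul1r {1}/face take0 /= drop0.
congr (_ + _); rewrite -sumrN; apply: eq_bigr => i _.
by rewrite /bump /= add1n exprS mulN1r mulNr.
Qed.

Lemma coboundaryZ c f h :
  coboundary (fun t => c * f t) h = c * coboundary f h.
Proof.
by rewrite /coboundary big_distrr; apply: eq_bigr => i _ /=; rewrite mulrCA.
Qed.

End Coboundary.

(** * Strong alternation as a cup power of the carry cocycle *)

Section Cocycle.
Variables (k : nat) (hk : (1 < k)%N).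
Implicit Types (x y z w : 'Z_k) (h : seq 'Z_k).

Definition carry x y z : bool := (k <= (y - x)%R + (z - y)%R)%N.

Lemma Zp_ltn x : (x < k)%N.
Proof. by have := ltn_ord x; rewrite [X in (_ < X)%N -> _]Zp_cast. Qed.

Lemma carryE x y z :
  ((y - x)%R + (z - y)%R = (z - x)%R + k * carry x y z :> nat)%N.
Proof.
have addE (a b : 'Z_k) : (a + b)%R = ((a + b) %% k)%N :> nat.
  transitivity ((a + b) %% (Zp_trunc k).+2)%N; first by [].
  by congr modn; exact: Zp_cast.
have -> : z - x = (y - x) + (z - y) by ring.
rewrite (addE (y - x)) /carry.
have lt1 := Zp_ltn (y - x); have lt2 := Zp_ltn (z - y).
case: leqP => H; last by rewrite modn_small // muln0 addn0.
rewrite -[in RHS](subnK H) modnDr modn_small; lia.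
Qed.

(** By [carryE] both sides, multiplied by [k], equal the sum of the steps from
    x to y to z to w minus the step from x to w. *)
Lemma carry_cocycle x y z w :
  (carry y z w + carry x y w = carry x z w + carry x y z :> nat)%N.
Proof.
have := carryE y z w; have := carryE x y w.
have := carryE x z w; have := carryE x y z.
have : (0 < k)%N by lia.
by case: (carry y z w) (carry x y w) (carry x z w) (carry x y z)
  => [] [] [] []; rewrite ?muln0 ?muln1; lia.
Qed.

(** Comparing [carryE] at (e, x, y) and (g, x, y): the steps from g are one less
    than the steps from e, up to a wrap-around at the identity. *)
Lemma carry_shift x y :
  (carry 0%R x y + (x == 0%R) = carry 1%R x y + (y == 0%R) :> nat)%N.
Proof.
have predE (z : 'Z_k) : ((z - 1)%R + 1 = z + k * (z == 0%R))%N.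
  (* the carry of (e, g, z) occurs exactly when z is the identity *)
  have := carryE 0 1 z; rewrite /carry !subr0.
  have -> : nat_of_ord (1 : 'Z_k) = 1%N by [].
  have lt1 := Zp_ltn (z - 1); have lt2 := Zp_ltn z.
  have -> : (z == 0) = (nat_of_ord z == 0%N) by [].
  move: (nat_of_ord (z - 1)) lt1 => p lt1; move: (nat_of_ord z) lt2 => q lt2.
  case: eqP => z0; case: leqP => H; rewrite ?muln0 ?muln1; lia.
have := carryE 0 x y; have := carryE 1 x y; have := predE x; have := predE y.
rewrite !subr0; have : (0 < k)%N by lia.
move: (nat_of_ord (x - 1)) (nat_of_ord (y - 1)) (nat_of_ord (y - x)) => p q d.
move: (nat_of_ord x) (nat_of_ord y) => a b.
by case: (carry 0 x y) (carry 1 x y) (x == 0) (y == 0) => [] [] [] [];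
  rewrite ?muln0 ?muln1; lia.
Qed.

Lemma strongly_alternating0 h : strongly_alternating 0 h.
Proof. by apply/forallP => -[]. Qed.

Lemma strongly_alternatingS s x y z h :
  strongly_alternating s.+1 [:: x, y, z & h] =
  carry x y z && strongly_alternating s (z :: h).
Proof.
apply/forallP/andP => [H|[c /forallP H] i].
  by split; [exact: (H ord0) | apply/forallP => i; exact: (H (lift ord0 i))].
by case: (unliftP ord0 i) => [j|] ->; [exact: (H j) | exact: c].
Qed.

Variable R : comPzRingType.

Definition sa_cochain s h : R := (strongly_alternating s h)%:R.

Lemma sa_cochainS s x y z h :
  sa_cochain s.+1 [:: x, y, z & h] = (carry x y z)%:R * sa_cochain s (z :: h).
Proof. by rewrite /sa_cochain strongly_alternatingS -natrM mulnb. Qed.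

(** The Leibniz rule for a cup product of cocycles, by induction on the number
    of factors: deleting an entry beyond the third leaves the first carry alone,
    and the remaining deletions contribute the cocycle identity of the carry. *)
Lemma coboundary_sa_eq0 s h :
  size h = s.+1.*2 -> coboundary (sa_cochain s) h = 0.
Proof.
elim: s h => [|s IH] [|x [|y h]] //.
  case: h => // _; rewrite !coboundary_cons /coboundary big_ord0.
  by rewrite /sa_cochain !strongly_alternating0 subr0 subrr.
case: h => [|z [|w h]] // [hsz].
have {}hsz : size [:: z, w & h] = s.+1.*2 by rewrite /= hsz; lia.
(* the cocycle condition on [:: z, w & h], solved for the deletion of z *)
have tailE :
    coboundary (fun t => sa_cochain s (z :: t)) (w :: h) = sa_cochain s (w :: h).
  by have := IH _ hsz; rewrite coboundary_cons => /eqP; rewrite subr_eq0 => /eqP.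
rewrite 3!coboundary_cons !sa_cochainS.
rewrite (_ : coboundary _ (w :: h) = (carry x y z)%:R * sa_cochain s (w :: h));
  last first.
  by rewrite -tailE -coboundaryZ; apply: eq_bigr => i _; rewrite sa_cochainS.
have /(congr1 (GRing.natmul (1 : R))) := carry_cocycle x y z w.
rewrite !natrD => /eqP; rewrite -subr_eq0 => /eqP E.
by rewrite -[RHS](mul0r (sa_cochain s (w :: h))) -E; ring.
Qed.

(** The cocycle condition on a sequence starting with the generator, solved for
    the term in which that first entry is deleted. *)
Lemma coboundary_sa_generator s h :
  size h = s.*2.+1 ->
  coboundary (fun t => sa_cochain s (1 :: t)) h = sa_cochain s h.
Proof.
move=> hsz; have := coboundary_sa_eq0 (s := s) (h := 1 :: h).
rewrite coboundary_cons /= hsz => /(_ erefl)/eqP.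
by rewrite subr_eq0 => /eqP.
Qed.

(** Deleting any entry but the first keeps [x] in front, so these terms sum to
    [x == 0] times the value on [y :: h] by the cocycle condition; deleting [x]
    gives [y == 0] times the same value. *)
Lemma coboundary_sa_identity s h : size h = s.*2.+2 ->
  coboundary (fun t => (strongly_alternating s t && (nth 0 t 0 == 0))%:R) h =
  sa_cochain s.+1 (0 :: h) - sa_cochain s.+1 (1 :: h).
Proof.
case: h => [|x [|y h]] // hsz; rewrite coboundary_cons !sa_cochainS.
rewrite (_ : coboundary _ _ = (x == 0)%:R * sa_cochain s (y :: h)); last first.
  have /eqP := coboundary_sa_eq0 hsz.
  rewrite coboundary_cons subr_eq0 => /eqP ->; rewrite -coboundaryZ.
  by apply: eq_bigr => i _; rewrite -natrM mulnb andbC.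
have /(congr1 (GRing.natmul (1 : R))) := carry_shift x y.
rewrite !natrD -mulnb natrM -/(sa_cochain s (y :: h)) /=.
move=> /eqP; rewrite -subr_eq0 => /eqP E.
apply/eqP; rewrite -subr_eq0 -[X in _ == X](mul0r (- sa_cochain s (y :: h))) -E.
by apply/eqP; ring.
Qed.

End Cocycle.

(** * Pairing cochains with pattern chains *)

Section Count.
Variables (k : nat) (R : comPzRingType) (r : nat).

Definition pairing (f : seq 'Z_k -> R) (z : patterns k R r) : R :=
  \sum_(h : r.+1.-tuple 'Z_k) z@_h * f h.

Variable f : seq 'Z_k -> R.

Fact pairing_is_scalar : scalar (pairing f).
Proof.
move=> c y z; rewrite /pairing big_distrr -big_split /=.
by apply: eq_bigr => h _; rewrite mcoeffD fm_coeffZ mulrDl mulrA.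
Qed.

HB.instance Definition _ :=
  GRing.isLinear.Build R (patterns k R r) R *%R (pairing f) pairing_is_scalar.

Lemma pairing_gen (h : r.+1.-tuple 'Z_k) : pairing f (fm_gen R h) = f h.
Proof.
rewrite /pairing (bigD1 h) //= mcoeffUU mul1r big1 ?addr0 => // t th.
by rewrite mcoeffU eq_sym (negbTE th) mul0r.
Qed.

Lemma pattern_countE (V : choiceType) (X : simplicial_complex V)
    (l : labelling k V) (y : chain R X r) (P : pred (seq 'Z_k)) :
  pattern_count l y P = \sum_(h : r.+1.-tuple 'Z_k) (pattern l y)@_h * (P h)%:R.
Proof.
rewrite /pattern_count big_mkcond; apply: eq_bigr => h _.
by case: (P h); rewrite ?mulr1 ?mulr0.
Qed.

End Count.

Lemma free_module_decomp (R : pzRingType) (K : choiceType)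
    (y : free_module R K) :
  y = \sum_(x <- msupp y) y@_x *: fm_gen R x.
Proof.
rewrite {1}[y]monalgE; apply: eq_bigr => x _; apply/malgP => z.
by rewrite fm_coeffZ !mcoeffU mulrb; case: eqP => _; rewrite ?mulr1 ?mulr0.
Qed.

(** * Patterns of simplices *)

Section SimplexPattern.
Variables (k : nat) (R : comPzRingType) (V : choiceType) (l : labelling k V).

Let color (u : V) : nat := (l u).2.

Lemma simplex_pattern_eq0 r (v : r.+1.-tuple V) (i j : 'I_r.+1) :
  i != j -> color (tnth v i) = color (tnth v j) -> simplex_pattern R l v = 0.
Proof.
move=> ij cij; rewrite /simplex_pattern; case: pickP => [p|//] /forallP hp.
have lt_color (a b : 'I_r.+1) :
    (a < b)%N -> (color (tnth v (p a)) < color (tnth v (p b)))%N.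
  by move/forallP/(_ b)/implyP: (hp a); apply.
case: (ltngtP (p^-1%g i) (p^-1%g j)) => [/lt_color|/lt_color|/val_inj/perm_inj eij].
- by rewrite !permKV cij ltnn.
- by rewrite !permKV cij ltnn.
by rewrite eij eqxx in ij.
Qed.

Lemma eq_simplex_pattern r (v w : r.+1.-tuple V) :
  (forall i, l (tnth v i) = l (tnth w i)) ->
  simplex_pattern R l v = simplex_pattern R l w.
Proof.
move=> evw; rewrite /simplex_pattern.
rewrite (eq_pick (Q := color_sorts l w)); last first.
  by move=> p; apply: eq_forallb => i; apply: eq_forallb => j; rewrite !evw.
case: pickP => [p _|//].
have -> : [tuple (l (tnth v (p i))).1 | i < r.+1] =
    [tuple (l (tnth w (p i))).1 | i < r.+1].
  by apply: eq_mktuple => i; rewrite evw.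
by [].
Qed.

Lemma simplex_pattern_sorted r (v : r.+1.-tuple V) :
  (forall i j : 'I_r.+1, (i < j)%N -> (color (tnth v i) < color (tnth v j))%N) ->
  simplex_pattern R l v = fm_gen R (map_tuple (fst \o l) v).
Proof.
move=> cv; rewrite (@simplex_patternE _ _ _ _ _ _ 1%g); last first.
  by apply/'forall_forallP => i j; apply/implyP; rewrite !perm1; apply: cv.
rewrite odd_perm1 expr0 scale1r; congr fm_gen.
by apply: eq_from_tnth => i; rewrite tnth_mktuple tnth_map perm1.
Qed.

End SimplexPattern.

Lemma subfamily_lift (T : Type) r (v : r.+1.-tuple T) (i : 'I_r.+1) :
  subfamily v (lift i) = face i v :> seq T.
Proof.
have x0 := tnth v i.
have szf : size (face i v) = r.
  rewrite /face size_cat size_drop size_take_min size_tuple.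
  by have := ltn_ord i; lia.
apply: (@eq_from_nth _ x0) => [|j]; rewrite size_tuple ?szf // => jr.
rewrite -[LHS](tnth_nth x0 _ (Ordinal jr)) tnth_mktuple (tnth_nth x0) /=.
rewrite /face nth_cat size_take_min size_tuple /bump.
have := ltn_ord i; case: (leqP i j) => ij ir.
  rewrite ifF ?nth_drop; last by lia.
  by congr nth; lia.
by rewrite ifT ?nth_take //; lia.
Qed.

(** * Chains are spanned by color-sorted simplices *)

Section Simplices.
Local Open Scope fset_scope.
Local Open Scope ring_scope.
Variables (R : comPzRingType) (V : choiceType) (X : simplicial_complex V).

Lemma sub_simplex m n (v : n.-tuple V) (f : 'I_m.+1 -> 'I_n) :
  injective f -> uniq v -> faces X [fset x in (v : seq V)] ->
  uniq (subfamily v f) /\ faces X [fset x in (subfamily v f : seq V)].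
Proof.
move=> fI /tuple_uniqP vI fv; split.
  by apply/tuple_uniqP => a b; rewrite !tnth_mktuple => /vI/fI.
have wv : {subset subfamily v f <= v}.
  by move=> x /tnthP[j ->]; rewrite tnth_mktuple mem_tnth.
case: X fv => F F0 F1 FS /= fv; apply: FS fv _ _.
  by apply/fsubsetP => x; rewrite !inE => /wv.
by apply/fset0Pn; exists (tnth (subfamily v f) ord0); rewrite inE; exact: mem_tnth.
Qed.

Variable color : V -> nat.

Lemma sorting_perm n (v : n.-tuple V) :
  exists p : 'S_n, sorted leq (map color (subfamily v p)).
Proof.
have /tuple_permP[p pE] : perm_eq (sort (relpre color leq) v) v.
  by rewrite perm_sort.
exists p; rewrite sorted_map [X in sorted _ X](_ : _ = sort (relpre color leq) v) //.
by apply: sort_sorted => x y; exact: leq_total.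
Qed.

(** Changing the orientation of a simplex only costs a sign, so the vertices of
    each generator may be listed by increasing color. *)
Lemma chain_ind_sorted r (P : chain R X r -> Prop) :
  P 0 -> (forall c y z, P y -> P z -> P (c *: y + z)) ->
  (forall v : r.+1.-tuple V, uniq v -> faces X [fset x in (v : seq V)] ->
     sorted leq (map color v) -> P (oriented R X v)) ->
  forall y, P y.
Proof.
move=> P0 PD PO y; rewrite [y]free_module_decomp.
elim/big_ind: _ => // [y1 y2 Py1 Py2|A _].
  by rewrite -[y1]scale1r; apply: PD.
have [p sp] := sorting_perm (verts A).
have -> : y@_A *: fm_gen R A =
    (y@_A * (-1) ^+ p) *: oriented R X (subfamily (verts A) p) + 0.
  by rewrite oriented_verts scalerA -mulrA -signr_addb addbb mulr1 addr0.
apply: PD => //; apply: PO => //; last first.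
  by rewrite fset_verts; case/andP: (valP A).
by apply/tuple_uniqP => a b; rewrite !tnth_mktuple => /verts_inj/perm_inj.
Qed.

End Simplices.

(** * Patterns of boundaries *)

Lemma sum_two_terms (M : nmodType) (I : finType) (F : I -> M) (i j : I) :
  j != i ->
  (forall m, m != i -> m != j -> F m = 0) -> \sum_m F m = F i + F j.
Proof.
move=> ji F0; rewrite (bigD1 i) //= (bigD1 j) //= big1 ?addr0 // => m /andP[].
exact: F0.
Qed.

Section SortedSimplex.
Local Open Scope fset_scope.
Local Open Scope ring_scope.
Variables (k : nat) (R : comPzRingType) (V : choiceType).
Variables (X : simplicial_complex V) (l : labelling k V) (r : nat).
Variable v : r.+2.-tuple V.
Hypotheses (ladm : admissible X l) (uv : uniq v).
Hypothesis fv : faces X [fset x in (v : seq V)].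
Hypothesis sv : sorted leq [seq (l u).2 | u <- v].

Let color (i : 'I_r.+2) : nat := (l (tnth v i)).2.

Lemma color_homo (i j : 'I_r.+2) : (i <= j)%N -> (color i <= color j)%N.
Proof.
move=> ij; have x0 := tnth v i.
have H (a : 'I_r.+2) : color a = nth 0%N [seq (l u).2 | u <- v] a.
  by rewrite (nth_map x0) ?size_tuple // /color (tnth_nth x0).
rewrite !H; apply: (sorted_leq_nth leq_trans leqnn) => //;
  by rewrite inE size_map size_tuple.
Qed.

Lemma pattern_boundary :
  pattern l (boundary (oriented R X v)) =
  \sum_(i < r.+2) (-1) ^+ i *: simplex_pattern R l (subfamily v (lift i)).
Proof.
rewrite boundary_oriented // linear_sum; apply: eq_bigr => i _.
have [? ?] := sub_simplex (@lift_inj _ i) uv fv.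
by rewrite linearZ /= pattern_oriented.
Qed.

(** This is where admissibility enters: two vertices of a simplex span an edge. *)
Lemma same_color_same_label (i j : 'I_r.+2) :
  color i = color j -> l (tnth v i) = l (tnth v j).
Proof.
move=> cij; have [->//|ij] := eqVneq i j.
have vij : tnth v i != tnth v j.
  by apply: contraNneq ij => /(tuple_uniqP _ uv) ->.
have fij : faces X [fset tnth v i; tnth v j].
  case: X fv => F F0 F1 FS /= fv'; apply: FS fv' _ _.
    by apply/fsubsetP => x; rewrite !inE => /orP[]/eqP->; rewrite mem_tnth.
  by apply/fset0Pn; exists (tnth v i); rewrite !inE eqxx.
case: (ladm vij fij) => [/(_ cij)//|sij].
by rewrite [LHS]surjective_pairing [RHS]surjective_pairing sij [X in (_, X)]cij.
Qed.

(** The faces opposite to [i] and [j] carry the same labels in the same order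
    because [i] and [j] are adjacent, so they cancel; any other face contains
    both vertices. *)
Lemma pattern_boundary_eq0 (i j : 'I_r.+2) :
  j = i.+1 :> nat -> color i = color j ->
  \sum_(m < r.+2) (-1) ^+ m *: simplex_pattern R l (subfamily v (lift m)) = 0.
Proof.
move=> ji cij; have ij : j != i by rewrite -val_eqE /= ji; lia.
have eq_faces : simplex_pattern R l (subfamily v (lift i)) =
    simplex_pattern R l (subfamily v (lift j)).
  apply: eq_simplex_pattern => a; rewrite !tnth_mktuple.
  have [ai|ai] := eqVneq (nat_of_ord a) i.
    have -> : lift i a = j by apply: ord_inj; rewrite /= /bump ji ai; lia.
    have -> : lift j a = i by apply: ord_inj; rewrite /= /bump ji ai; lia.
    exact/esym/same_color_same_label.
  by have -> : lift i a = lift j a by apply: ord_inj; rewrite /= /bump ji; lia.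
rewrite (sum_two_terms ij) => [|m mi mj].
  by rewrite ji exprS mulN1r scaleNr eq_faces subrr.
case: (unliftP m i) => [i' ei|ei]; last by rewrite ei eqxx in mi.
case: (unliftP m j) => [j' ej|ej]; last by rewrite ej eqxx in mj.
have i'j' : i' != j' by apply: contraNneq ij => eij; rewrite ei ej eij.
rewrite (simplex_pattern_eq0 R i'j'); first exact: scaler0.
by rewrite !tnth_mktuple -ei -ej.
Qed.

(** Weakly increasing colors are strictly increasing as soon as no two
    consecutive ones agree, which separates the degenerate case, where both
    sides vanish, from the one where faces commute with taking labels. *)
Lemma pairing_sorted_boundary (f : seq 'Z_k -> R) :
  pairing f (pattern l (boundary (oriented R X v))) =
  pairing (coboundary f) (pattern l (oriented R X v)).
Proof.
rewrite pattern_boundary pattern_oriented //.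
pose low (i : 'I_r.+1) := widen_ord (leqnSn r.+1) i.
have [/existsP[i /eqP ci]|] :=
    boolP [exists i, color (low i) == color (lift ord0 i)].
  have ii1 : low i != lift ord0 i by rewrite -val_eqE /= /bump; lia.
  rewrite (pattern_boundary_eq0 (i := low i) (j := lift ord0 i)) //.
  by rewrite (simplex_pattern_eq0 R ii1 ci) !linear0.
move=> /existsPn cS.
have cv (i j : 'I_r.+2) : (i < j)%N -> (color i < color j)%N.
  move=> ij; have ir : (i < r.+1)%N by have := ltn_ord j; lia.
  have := cS (Ordinal ir); rewrite (_ : low _ = i); last exact: val_inj.
  move=> ne; apply: (@leq_trans (color (lift ord0 (Ordinal ir)))).
    by rewrite ltn_neqAle ne color_homo //= /bump; lia.
  by apply: color_homo; rewrite /= /bump; lia.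
rewrite (simplex_pattern_sorted _ cv) pairing_gen linear_sum /coboundary.
rewrite size_map size_tuple; apply: eq_bigr => i _.
rewrite linearZ /= simplex_pattern_sorted => [|a b ab]; last first.
  by rewrite !tnth_mktuple; apply: cv; rewrite /= /bump; lia.
by rewrite pairing_gen /= subfamily_lift /face map_cat map_take map_drop.
Qed.

End SortedSimplex.

Lemma pattern_chain_map (k : nat) (R : comPzRingType) (V : choiceType)
    (X : simplicial_complex V) (l : labelling k V) (r : nat)
    (f : seq 'Z_k -> R) (x : chain R X r.+1) :
  admissible X l ->
  pairing f (pattern l (boundary x)) = pairing (coboundary f) (pattern l x).
Proof.
move=> ladm; pose color u := (l u).2.
elim/(@chain_ind_sorted R V X color): x => [|c y z IHy IHz|v uv fv sv].
- by rewrite !linear0.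
- by rewrite !linearP /= IHy IHz.
exact: pairing_sorted_boundary.
Qed.

Theorem theorem4p1 (k : nat) (hk : (2 <= k)%N) (R : comPzRingType)
    (V : choiceType) (X : simplicial_complex V)
    (l : labelling k V) (hl : is_labelling l) (ladm : admissible X l)
    (r : nat) (x : chain R X r.+1) :
  (forall s : nat, r.+1 = s.*2 ->
     pattern_count l (boundary x) (fun h => strongly_alternating s (1 :: h)) =
     pattern_count l x (fun h => strongly_alternating s h)) /\
  (forall s : nat, r.+1 = s.*2.+1 ->
     pattern_count l (boundary x)
       (fun h => strongly_alternating s h && (nth 0 h 0 == 0)) =
     pattern_count l x (fun h => strongly_alternating s.+1 (0 :: h)) -
     pattern_count l x (fun h => strongly_alternating s.+1 (1 :: h))).
Proof.
split=> s rs; rewrite !pattern_countE.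
  rewrite [LHS](pattern_chain_map (fun h => sa_cochain R s (1 :: h)) _ ladm).
  by apply: eq_bigr => h _; rewrite coboundary_sa_generator // size_tuple rs.
rewrite [LHS](pattern_chain_map
  (fun h => (strongly_alternating s h && (nth 0 h 0 == 0))%:R) _ ladm).
rewrite -sumrB; apply: eq_bigr => h _.
by rewrite coboundary_sa_identity ?size_tuple ?rs // mulrBr.
Qed.
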